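(* Let $\phi: L^1_+\to L^1_+$ be an allocation rule. Then $\phi$ satisfies feasibility, scale invariance, independence of a future income, consistency and sup-continuity if and only if there is a function $\lambda:\mathbb{Z}\to[0,1]$ such that $\phi=\phi^\lambda$ is the geometric rule associated with $\lambda$ and the set $\{S^\lambda_i: i\in\mathbb{Z}\}$ is bounded from above (by a real number), where $$S^\lambda_i=\lambda_i\sum_{j\in\mathbb{Z}:\, j\le i}\ \prod_{k=j}^{i-1}(1-\lambda_k).$$
   Context: $L^1$ is the set of functions $r:\mathbb{Z}\to\mathbb{R}$, $i\mapsto r_i$, with $\sum_{i\in\mathbb{Z}}|r_i|<+\infty$, and $L^1_+$ is the subset of those with $r_i\ge 0$ for all $i$. An allocation rule is any function $\phi:L^1_+\to L^1_+$; $\phi_i(r)$ denotes the $i$-th coordinate of $\phi(r)$. Empty products equal $1$. Geometric rule associated with $\lambda:\mathbb{Z}\to[0,1]$: the allocation rule $\phi^\lambda$ given, for each $r\in L^1_+$ and $i\in\mathbb{Z}$, by $\phi^\lambda_i(r)=\lambda_i\sum_{j\le i}\prod_{k=j}^{i-1}(1-\lambda_k)r_j$. The quantity $S^\lambda_i$ is taken in $[0,+\infty]$, with the convention $0\cdot(+\infty)=0$ (equivalently, $S_i^\lambda=\sum_{j\le i}\lambda_i\prod_{k=j}^{i-1}(1-\lambda_k)$); boundedness from above means there is $b\in\mathbb{R}$ with $S^\lambda_i\le b$ for every $i\in\mathbb{Z}$. Axioms for an allocation rule $\phi$: Feasibility: for each $r\in L^1_+$, $\sum_{i\in\mathbb{Z}}\phi_i(r)\le\sum_{i\in\mathbb{Z}}r_i$.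 Scale invariance: for each $r\in L^1_+$ and each real $\alpha\ge 0$, $\phi(\alpha r)=\alpha\phi(r)$. Independence of a future income: if $j\in\mathbb{Z}$ and $r,r'\in L^1_+$ satisfy $r_i=r'_i$ for each $i\in\mathbb{Z}\setminus\{j\}$, then $\phi_i(r)=\phi_i(r')$ for each $i<j$. Consistency: given $\phi$, $r\in L^1_+$ and $j\in\mathbb{Z}$, define the stream $r^j:\mathbb{Z}\to\mathbb{R}$ by $r^j_i=r_i$ if $i>j$; $r^j_j=r_j+\sum_{i<j}(r_i-\phi_i(r))$; $r^j_i=0$ if $i<j$. The axiom requires that for each $r\in L^1_+$ and each $j\in\mathbb{Z}$ such that $r^j\in L^1_+$, one has $\phi_i(r)=\phi_i(r^j)$ for each $i\ge j$. Sup-continuity: whenever $r\in L^1_+$ and $(r^m)_{m\ge 0}$ is a sequence in $L^1_+$ with $\sup_{i\in\mathbb{Z}}|r^m_i-r_i|\to 0$ as $m\to\infty$, then $\sup_{i\in\mathbb{Z}}|\phi_i(r^m)-\phi_i(r)|\to 0$ as $m\to\infty$. *)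

(* Defs.v *)
From mathcomp Require Import all_boot all_order all_algebra.
From mathcomp Require Import boolp classical_sets functions fsbigop reals ereal.
From mathcomp Require Import interval_inference topology normedtype numfun.
From mathcomp Require Import sequences esum.

Set Implicit Arguments.
Unset Strict Implicit.
Unset Printing Implicit Defensive.

Import Order.TTheory GRing.Theory Num.Theory.
Import numFieldNormedType.Exports.

Local Open Scope classical_set_scope.
Local Open Scope ring_scope.

Definition in_L1 (R : realType) (r : int -> R) : Prop :=
  summable [set: int] (EFin \o r).

Definition in_L1plus (R : realType) (r : int -> R) : Prop :=
  in_L1 r /\ forall i : int, 0 <= r i.

Record L1plus (R : realType) := MkL1plus {
  stream_fun :> int -> R;
  stream_funP : in_L1plus stream_fun
}.

Lemma in_L1plus_scale (R : realType) (alpha : R) (alpha0 : 0 <= alpha)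
  (r : L1plus R) : in_L1plus (fun i => alpha * r i).
Proof.
have [sr r0] := stream_funP r.
split=> [|i]; last by rewrite mulr_ge0.
have fr : (\esum_(i in [set: int]) `|(r i)%:E| \is a fin_num)%E.
  by have := summableE [set: int] (EFin \o r) => <-.
apply: (@le_lt_trans _ _
  (alpha%:E * \esum_(i in [set: int]) `|(r i)%:E|)%E); last first.
  by rewrite -(fineK fr) -EFinM ltry.
apply: ge_ereal_sup => _ [A [finA _] <-].
rewrite (eq_fsbigr (fun i => (alpha%:E * `|(r i)%:E|)%E)); last first.
  by move=> i _ /=; rewrite normrM (ger0_norm alpha0).
rewrite -ge0_mule_fsumr; last by move=> i; exact: abse_ge0.
apply: lee_pmul => //.
  by rewrite fsbig_finite//=; apply: sume_ge0.
by apply: ereal_sup_ubound; exists A.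
Qed.

Definition scale_L1plus (R : realType) (alpha : R) (alpha0 : 0 <= alpha)
  (r : L1plus R) : L1plus R := MkL1plus (in_L1plus_scale alpha0 r).

(* Sum over D of a signed, absolutely summable family: [esum] is only the sum
   of nonnegative families, so positive and negative parts are summed apart. *)
Definition signed_sum (R : realType) (D : set int) (f : int -> R) : R :=
  fine (\esum_(i in D) ((EFin \o f)^\+ i)%E
        - \esum_(i in D) ((EFin \o f)^\- i)%E)%E.

(* The product of 1 - lam k over the integers k with j <= k <= i - 1; it is
   only used for j <= i. *)
Definition carry (R : realType) (lam : int -> R) (j i : int) : R :=
  \prod_(n < `|i - j|%N) (1 - lam (j + n%:Z)).

(* The identity is stated in \bar R, so that it includes the convergence of the
   series. *)
Definition is_geometric_rule (R : realType) (lam : int -> R)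
    (phi : L1plus R -> L1plus R) : Prop :=
  forall (r : L1plus R) (i : int),
    ((phi r i)%:E =
     (lam i)%:E * \esum_(j in [set j : int | (j <= i)%R]) (carry lam j i * r j)%R%:E)%E.

(* In \bar R, 0 * +oo = 0. *)
Definition Slam (R : realType) (lam : int -> R) (i : int) : \bar R :=
  ((lam i)%:E * \esum_(j in [set j : int | (j <= i)%R]) (carry lam j i)%:E)%E.

Definition feasibility (R : realType) (phi : L1plus R -> L1plus R) : Prop :=
  forall r : L1plus R,
    (\esum_(i in [set: int]) (phi r i)%:E
     <= \esum_(i in [set: int]) (r i)%:E)%E.

Definition scale_invariance (R : realType)
    (phi : L1plus R -> L1plus R) : Prop :=
  forall (r : L1plus R) (alpha : R) (alpha0 : 0 <= alpha),
    phi (scale_L1plus alpha0 r) = scale_L1plus alpha0 (phi r).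

Definition independence_of_future_income (R : realType)
    (phi : L1plus R -> L1plus R) : Prop :=
  forall (j : int) (r r' : L1plus R),
    (forall i : int, i != j -> r i = r' i) ->
    forall i : int, i < j -> phi r i = phi r' i.

Definition residual_stream (R : realType) (phi : L1plus R -> L1plus R)
    (r : L1plus R) (j : int) : int -> R := fun i =>
  if j < i then r i
  else if i == j then
    r j + signed_sum [set k : int | k < j] (fun k => r k - phi r k)
  else 0.

Definition consistency (R : realType) (phi : L1plus R -> L1plus R) : Prop :=
  forall (r : L1plus R) (j : int)
    (rj : in_L1plus (residual_stream phi r j)) (i : int),
    j <= i -> phi r i = phi (MkL1plus rj) i.

Definition sup_dist (R : realType) (r s : int -> R) : \bar R :=
  ereal_sup [set (`|r i - s i|)%:E | i in [set: int]].

Definition sup_continuity (R : realType) (phi : L1plus R -> L1plus R) : Prop :=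
  forall (r : L1plus R) (rm : nat -> L1plus R),
    sup_dist (rm m) r @[m --> \oo] --> (0%:E : \bar R) ->
    sup_dist (phi (rm m)) (phi r) @[m --> \oo] --> (0%:E : \bar R).

(* Main.v *)
Require Import Defs.
From mathcomp Require Import all_boot all_order all_algebra.
From mathcomp Require Import boolp classical_sets reals ereal.
From mathcomp Require Import functions cardinality fsbigop topology normedtype.
From mathcomp Require Import numfun sequences esum.
From mathcomp Require Import zify lra.

(** Let [w i] be the sum of [carry lam j i * r j] over [j <= i].  It satisfies
[w (i + 1) = r (i + 1) + (1 - lam i) * w i], so [r k - lam k * w k] telescopes
and what is left unpaid before [j] is [(1 - lam (j - 1)) * w (j - 1)].  This
gives feasibility and consistency of a geometric rule, and [Slam lam] bounds its
Lipschitz constants for the sup distance.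

Conversely let [lam i] be what the unit stream at [i] pays at [i].  For a
finitely supported [r], consistency and independence replace [r] by [w i] times
the unit stream at [i] when computing the payment at [i], by induction on [i].
Continuity at the zero stream bounds the rule on indicator streams, hence
bounds [Slam lam]; both sides are then continuous and finitely supported
streams are dense. *)

Set Implicit Arguments.
Unset Strict Implicit.
Unset Printing Implicit Defensive.

Import Order.TTheory GRing.Theory Num.Theory.
Import numFieldNormedType.Exports.

Local Open Scope classical_set_scope.
Local Open Scope ring_scope.

(** * Sums over all integers up to a given one *)

Notation past f i := (esum [set j : int | (j <= i)%R] f).

Section past_sums.
Context {R : realType}.
Implicit Types (f : int -> \bar R) (i : int).

(** The substitution [j = i - k] turns a past sum into an ordinary series, to which shifts, tails
    and limits apply. *)
Lemma past_nneseries f i : (forall j, 0 <= f j)%E ->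
  past f i = (\sum_(0 <= k <oo) f (i - k%:Z)%R)%E.
Proof.
move=> f0; rewrite nneseries_esumT//.
apply: (@reindex_esum _ _ _ _ _ (fun k : nat => i - k%:Z)); split.
- by move=> k _ /=; lia.
- by move=> k l _ _ /=; lia.
- by move=> j /= ji; exists `|i - j|%N => //=; lia.
Qed.

Lemma past_recr f i : (forall j, 0 <= f j)%E ->
  past f (i + 1) = (f (i + 1)%R + past f i)%E.
Proof.
move=> f0; rewrite !past_nneseries// nneseries_recl// subr0; congr (_ + _)%E.
rewrite -nneseries_addn//; apply: eq_eseriesr => k _.
by congr f; lia.
Qed.

Lemma pastZl (c : R) f i : 0 <= c -> (forall j, 0 <= f j)%E ->
  past (fun j => c%:E * f j)%E i = (c%:E * past f i)%E.
Proof.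
move=> c0 f0; rewrite !past_nneseries ?nneseriesZl// => j.
by rewrite mule_ge0// lee_fin.
Qed.

Lemma esum_subset (A B : set int) f : A `<=` B ->
  (\esum_(j in A) f j <= \esum_(j in B) f j)%E.
Proof.
move=> AB; apply: ge_ereal_sup => _ [X [finX XA] <-].
by apply: ereal_sup_ubound; exists X => //; split=> //; exact: subset_trans AB.
Qed.

Lemma finite_set_int_bounded (A : set int) : finite_set A ->
  exists m : nat, forall j, A j -> (`|j| <= m)%N.
Proof.
move=> /finite_seqP[s ->]; exists (\max_(j <- s) `|j|)%N => j /= js.
exact: (@leq_bigmax_seq _ s predT (fun i => `|i|%N)).
Qed.

(** A finite set of integers lies below some [m], so each finite partial sum is one of those whose
    supremum is the past sum at [m]. *)
Lemma esumT_le_past f (M : \bar R) : (forall i, past f i <= M)%E ->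
  (\esum_(j in [set: int]) f j <= M)%E.
Proof.
move=> fM; apply: ge_ereal_sup => _ [X [finX _] <-].
have [m Xm] := finite_set_int_bounded finX.
apply: le_trans (fM m%:Z); apply: ereal_sup_ubound; exists X => //; split=> //.
by move=> j /Xm /=; lia.
Qed.
End past_sums.

(** * Streams in [L1plus] and uniform distance *)

Lemma L1plus_ge0 (R : realType) (r : L1plus R) j : 0 <= r j.
Proof. by case: (stream_funP r). Qed.

Lemma L1plus_esum_lty (R : realType) (r : L1plus R) (D : set int) :
  (esum D (EFin \o r) < +oo)%E.
Proof.
apply: le_lt_trans (stream_funP r).1.
apply: le_trans (esum_subset _ (@subsetT _ D)) _; apply: le_esum => j _ /=.
by rewrite lee_fin ler_norm.
Qed.

Lemma L1plus_esum_fin_num (R : realType) (r : L1plus R) (D : set int) :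
  esum D (EFin \o r) \is a fin_num.
Proof.
rewrite ge0_fin_numE ?L1plus_esum_lty// esum_ge0// => j _ /=.
by rewrite lee_fin L1plus_ge0.
Qed.

(** These past sums are the tails of the convergent series for the past sum at [i]. *)
Lemma past_tail_cvg0 (R : realType) (r : L1plus R) i :
  past (EFin \o r) (i - n%:Z) @[n --> \oo] --> 0%E.
Proof.
have r0 j : (0 <= (EFin \o r) j)%E by rewrite lee_fin L1plus_ge0.
have -> : (fun n : nat => past (EFin \o r) (i - n%:Z)) =
    (fun n => \sum_(n <= k <oo) (EFin \o r) (i - k%:Z)%R)%E.
  apply/funext => n; rewrite past_nneseries// -[RHS]nneseries_addn//.
  by apply: eq_eseriesr => k _; congr ((EFin \o r) _); lia.
apply: nneseries_tail_cvg => //; rewrite -past_nneseries//.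
exact: L1plus_esum_lty.
Qed.

Lemma L1plus_eq (R : realType) (r s : L1plus R) : r =1 s -> r = s.
Proof.
case: r s => [r rP] [s sP] /= /funext rs; case: _ / rs in sP *.
by rewrite (Prop_irrelevance rP sP).
Qed.

Lemma in_L1plus_le (R : realType) (r : L1plus R) (f : int -> R) :
  (forall i, 0 <= f i <= r i) -> in_L1plus f.
Proof.
move=> fr; split=> [|i]; last by case/andP: (fr i).
apply: le_lt_trans (L1plus_esum_lty r setT); apply: le_esum => i _ /=.
by case/andP: (fr i) => f0 ?; rewrite lee_fin ger0_norm.
Qed.

Lemma signed_sumB (R : realType) (D : set int) (r s : L1plus R) :
  signed_sum D (fun k => r k - s k) =
  fine (esum D (EFin \o r)) - fine (esum D (EFin \o s)).
Proof.
have summ (t : L1plus R) : summable D (EFin \o t).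
  rewrite /summable (eq_esum (b := EFin \o t)) ?L1plus_esum_lty// => i _ /=.
  by rewrite ger0_norm// L1plus_ge0.
rewrite /signed_sum (_ : EFin \o _ = (EFin \o r) \- (EFin \o s))%E//.
rewrite esumB//; [|by move=> i _; rewrite lee_fin L1plus_ge0..].
by rewrite fineB// L1plus_esum_fin_num.
Qed.

Lemma sup_dist_cvg0P (R : realType) (r : L1plus R) (rm : nat -> L1plus R) :
  sup_dist (rm m) r @[m --> \oo] --> (0%:E : \bar R) <->
  forall e : R, 0 < e -> \forall m \near \oo, forall i, `|rm m i - r i| <= e.
Proof.
have sup_ub m i : ((`|rm m i - r i|)%:E <= sup_dist (rm m) r)%E.
  by apply: ereal_sup_ubound; exists i.
have sup_le m e : (forall i, `|rm m i - r i| <= e) ->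
    (sup_dist (rm m) r <= e%:E)%E.
  by move=> me; apply: ge_ereal_sup => _ [i _ <-]; rewrite lee_fin.
have sup_ge0 m : (0 <= sup_dist (rm m) r)%E.
  by apply: le_trans (sup_ub m 0); rewrite lee_fin.
split.
  move=> /fine_cvgP[fin /cvgr0Pnorm_le c0] e e0.
  near=> m => i; rewrite -lee_fin; apply: le_trans (sup_ub m i) _.
  rewrite -[X in (X <= _)%E]fineK; last by near: m.
  rewrite lee_fin -[X in X <= _]ger0_norm ?fine_ge0//.
  by near: m; exact: c0.
move=> c0; apply/fine_cvgP; split.
  have := c0 _ ltr01; apply: filterS => m /sup_le m1.
  by rewrite ge0_fin_numE//; apply: le_lt_trans m1 _; exact: ltry.
apply/cvgr0Pnorm_le => e e0.
have := c0 _ e0; apply: filterS => m /sup_le me /=.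
rewrite ger0_norm ?fine_ge0// -lee_fin fineK//.
by rewrite ge0_fin_numE//; apply: le_lt_trans me _; exact: ltry.
Unshelve. all: by end_near. Qed.

(** If the epsilon-delta form fails at [r] for [e], choice yields for each [m] a stream within
    [1 / (m + 1)] of [r] whose image is not within [e] of [phi r]; this sequence contradicts
    [sup_continuity]. *)
Lemma sup_continuityP (R : realType) (phi : L1plus R -> L1plus R) :
  sup_continuity phi <->
  forall (r : L1plus R) (e : R), 0 < e -> exists2 d : R, 0 < d &
    forall s : L1plus R, (forall i, `|s i - r i| <= d) ->
      forall i, `|phi s i - phi r i| <= e.
Proof.
split=> [cont r e e0|cont r rm /sup_dist_cvg0P rmr]; last first.
  apply/sup_dist_cvg0P => e e0; have [d d0 rd] := cont r e e0.
  by have := rmr _ d0; apply: filterS => m /rd.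
apply: contrapT => nd.
have /choice[rm rmP] : forall m : nat, exists s : L1plus R,
    (forall i, `|s i - r i| <= m.+1%:R^-1) /\
    ~ (forall i, `|phi s i - phi r i| <= e).
  move=> m; apply: contrapT => /forallNP ns; apply: nd.
  exists m.+1%:R^-1 => [|s sr]; first by rewrite invr_gt0.
  by apply: contrapT => nse; exact: (ns s).
have rmr : sup_dist (rm m) r @[m --> \oo] --> (0%:E : \bar R).
  apply/sup_dist_cvg0P => d d0; near=> m => i.
  apply: le_trans ((rmP m).1 i) _; apply: ltW; near: m.
  exact: near_infty_natSinv_lt (PosNum d0).
have /sup_dist_cvg0P/(_ _ e0)[m _ /(_ m (leqnn m))] := cont r rm rmr.
exact: (rmP m).2.
Unshelve. all: by end_near. Qed.

(** * Carried wealth: recursion and telescoping *)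

Definition wealth (R : realType) (lam r : int -> R) (i : int) : \bar R :=
  past (fun j => (carry lam j i * r j)%:E) i.

Section carry_wealth.
Context {R : realType} (lam : int -> R).
Hypothesis lam01 : forall i, 0 <= lam i <= 1.
Implicit Types (r : int -> R) (i j : int).

Let lam_ge0 i : 0 <= lam i. Proof. by case/andP: (lam01 i). Qed.
Let onem_lam_ge0 i : 0 <= 1 - lam i.
Proof. by rewrite subr_ge0; case/andP: (lam01 i). Qed.
Let onem_lam_le1 i : 1 - lam i <= 1.
Proof. by rewrite lerBlDr lerDl. Qed.

Lemma carry_refl i : carry lam i i = 1.
Proof. by rewrite /carry subrr big_ord0. Qed.

Lemma carry_recr j i : j <= i ->
  carry lam j (i + 1) = (1 - lam i) * carry lam j i.
Proof.
move=> ji; rewrite /carry (_ : `|(i + 1)%R - j|%N = `|i - j|%N.+1); last by lia.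
rewrite big_ord_recr /= mulrC (_ : j + `|i - j|%N%:Z = i)//; lia.
Qed.

Lemma carry_ge0 j i : 0 <= carry lam j i.
Proof. exact: prodr_ge0. Qed.

Lemma carry_le1 j i : carry lam j i <= 1.
Proof. by apply: prodr_ile1 => k; rewrite onem_lam_ge0 onem_lam_le1. Qed.

Lemma wealth_recr r i : (forall j, 0 <= r j) ->
  wealth lam r (i + 1) = ((r (i + 1))%:E + (1 - lam i)%:E * wealth lam r i)%E.
Proof.
move=> r0; have cr0 k j : (0 <= (carry lam j k * r j)%:E)%E.
  by rewrite lee_fin mulr_ge0// carry_ge0.
rewrite /wealth past_recr// carry_refl mul1r; congr (_ + _)%E.
rewrite -pastZl//; apply: eq_esum => j /= ji.
by rewrite -EFinM mulrA carry_recr.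
Qed.

Lemma wealth_ge0 r i : (forall j, 0 <= r j) -> (0 <= wealth lam r i)%E.
Proof.
by move=> r0; apply: esum_ge0 => j _; rewrite lee_fin mulr_ge0// carry_ge0.
Qed.

Lemma wealth_le_past r i : (forall j, 0 <= r j) ->
  (wealth lam r i <= past (EFin \o r) i)%E.
Proof.
move=> r0; apply: le_esum => j _ /=.
by rewrite lee_fin ler_piMl// carry_le1.
Qed.

Lemma wealth_fin_num (r : L1plus R) i : wealth lam r i \is a fin_num.
Proof.
have r0 := L1plus_ge0 r.
rewrite ge0_fin_numE ?wealth_ge0//.
exact: le_lt_trans (wealth_le_past i r0) (L1plus_esum_lty r _).
Qed.

Let partial_telescope (r : int -> R) i n : (forall j, 0 <= r j) ->
  (\sum_(0 <= k < n) (lam (i - k%:Z))%:E * wealth lam r (i - k%:Z)%R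
     + (1 - lam i)%:E * wealth lam r i
   = \sum_(0 <= k < n) (r (i - k%:Z))%:E
     + (1 - lam (i - n%:Z)%R)%:E * wealth lam r (i - n%:Z)%R)%E.
Proof.
move=> r0; elim: n => [|n IH]; first by rewrite !big_nil subr0.
rewrite !big_nat_recr//= addeAC IH -!addeA; congr (_ + _)%E.
(* The paid share [lam] and the carried share [1 - lam] of the wealth at [i - n] add up to all of
   it, and [wealth_recr] then unfolds it one step further back. *)
rewrite addeC -ge0_muleDl ?lee_fin// -EFinD subrKC mul1e.
rewrite (_ : i - n%:Z = i - n.+1%:Z + 1); last by lia.
by rewrite wealth_recr.
Qed.

(** Limit of [partial_telescope] as [n] grows: the remainder is at most the past sum of [r] at
    [i - n], hence vanishes. *)
Lemma past_telescope (r : L1plus R) i :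
  (past (fun j => (lam j)%:E * wealth lam r j)
     i + (1 - lam i)%:E * wealth lam r i = past (EFin \o r) i)%E.
Proof.
have r0 := L1plus_ge0 r.
have w0 j := @wealth_ge0 r j r0.
have lw0 j : (0 <= (lam j)%:E * wealth lam r j)%E by rewrite mule_ge0// lee_fin.
have er0 j : (0 <= (EFin \o r) j)%E by rewrite lee_fin.
have fin : ((1 - lam i)%:E * wealth lam r i)%E \is a fin_num.
  by rewrite fin_numM// wealth_fin_num.
rewrite !past_nneseries//.
have d0 : ((1 - lam (i - n%:Z))%:E * wealth lam r (i - n%:Z))%E @[n --> \oo] --> 0%E.
  apply: (@squeeze_cvge _ _ _ _ (cst 0%E) _ (fun n : nat => past (EFin \o r) (i - n%:Z))).
  - apply: nearW => n; rewrite mule_ge0 ?lee_fin//=.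
    apply: le_trans (wealth_le_past _ r0).
    by rewrite gee_pMl// ?lee_fin// wealth_fin_num.
  - exact: cvg_cst.
  - exact: past_tail_cvg0.
have L : (\sum_(0 <= k < n) (lam (i - k%:Z))%:E * wealth lam r (i - k%:Z)%R
     + (1 - lam i)%:E * wealth lam r i)%E @[n --> \oo] -->
   (\sum_(0 <= k <oo) (lam (i - k%:Z))%:E * wealth lam r (i - k%:Z)%R
     + (1 - lam i)%:E * wealth lam r i)%E.
  apply: cvgeD; [exact: fin_num_adde_defl| |exact: cvg_cst].
  by apply: is_cvg_nneseries => n _ _; exact: lw0.
have L' : (\sum_(0 <= k < n) (r (i - k%:Z))%:E
     + (1 - lam (i - n%:Z)%R)%:E * wealth lam r (i - n%:Z)%R)%E @[n --> \oo] -->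
   (\sum_(0 <= k <oo) (EFin \o r) (i - k%:Z)%R + 0)%E.
  apply: cvgeD; [exact: fin_num_adde_defl| |exact: d0].
  by apply: is_cvg_nneseries => n _ _; exact: er0.
rewrite -[RHS]adde0; apply: cvg_unique L _ => //.
apply: cvg_trans L'; apply: near_eq_cvg; apply: nearW => n /=.
by rewrite partial_telescope.
Qed.

End carry_wealth.

(** * Geometric rules satisfy the axioms *)

Section geometric_rule.
Context {R : realType} (lam : int -> R).
Hypothesis lam01 : forall i, 0 <= lam i <= 1.
Implicit Types (r s : L1plus R) (i j : int).

Let lam_ge0 i : 0 <= lam i. Proof. by case/andP: (lam01 i). Qed.

Lemma eq_wealth (f g : int -> R) i : (forall j, j <= i -> f j = g j) ->
  wealth lam f i = wealth lam g i.
Proof. by move=> fg; apply: eq_esum => j /= ji; rewrite fg. Qed.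

Lemma wealth0 (f : int -> R) i : (forall j, j <= i -> f j = 0) ->
  wealth lam f i = 0%E.
Proof. by move=> f0; apply: esum1 => j /= ji; rewrite f0// mulr0. Qed.

Lemma wealth_singleton (f : int -> R) i : (forall j, 0 <= f j) ->
  (forall j, j < i -> f j = 0) -> wealth lam f i = (f i)%:E.
Proof.
move=> f_ge0 f0; rewrite -(subrK 1 i) wealth_recr// wealth0 ?mule0 ?adde0//.
by move=> j ji; apply: f0; lia.
Qed.

(** By [past_telescope] at [j - 1], what is unpaid before [j] is the carried part of the wealth
    there, and [wealth_recr] adds [r j] to it. Geometric payments are required only before [j], so
    that the lemma also serves inside the induction of the converse. *)
Lemma wealth_residual r s j :
  (forall k, k < j -> ((s k)%:E = (lam k)%:E * wealth lam r k)%E) ->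
  ((r j + signed_sum [set k : int | k < j] (fun k => r k - s k))%:E
   = wealth lam r j)%E.
Proof.
move=> sE; rewrite (_ : [set k | k < j] = [set k | k <= j - 1]); last first.
  by apply/seteqP; split=> k /=; lia.
rewrite signed_sumB -[j in RHS](subrK 1 j) (wealth_recr lam01); last exact: L1plus_ge0.
rewrite subrK EFinD EFinB !fineK ?L1plus_esum_fin_num//; congr (_ + _)%E.
rewrite -(past_telescope lam01 r) (eq_esum (b := fun k => (lam k)%:E * wealth lam r k)%E).
  rewrite addeAC subee ?add0e//.
  rewrite -(eq_esum (a := EFin \o s)) ?L1plus_esum_fin_num//.
  by move=> k /= kj; apply: sE; lia.
by move=> k /= kj; apply: sE; lia.
Qed.

(** [Slam lam i] is what the constant stream 1 would receive at [i], and payments are monotone and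
    additive. *)
Lemma wealth_dist (f g : int -> R) (d : R) i : (forall j, 0 <= g j) ->
  0 <= d -> (forall j, f j <= g j + d) ->
  ((lam i)%:E * wealth lam f i
   <= (lam i)%:E * wealth lam g i + d%:E * Slam lam i)%E.
Proof.
move=> g0 d0 fg; rewrite /Slam muleCA -ge0_muleDr; last 2 first.
- exact: wealth_ge0.
- by rewrite mule_ge0// ?lee_fin// esum_ge0// => j _; rewrite lee_fin carry_ge0.
apply: lee_wpmul2l; first by rewrite lee_fin.
rewrite -pastZl//; last by move=> j; rewrite lee_fin carry_ge0.
rewrite -esumD; last 2 first.
- by move=> j _; rewrite lee_fin mulr_ge0// carry_ge0.
- by move=> j _; rewrite -EFinM lee_fin mulr_ge0// carry_ge0.
apply: le_esum => j _; rewrite -EFinM -EFinD lee_fin (mulrC d) -mulrDr.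
by rewrite ler_wpM2l// carry_ge0.
Qed.

Variable phi : L1plus R -> L1plus R.
Hypothesis phiE : is_geometric_rule lam phi.

Let phi_wealth r i : (phi r i)%:E = ((lam i)%:E * wealth lam r i)%E.
Proof. exact: phiE. Qed.

(** By [past_telescope], income up to [i] exceeds payments up to [i] by the nonnegative amount
    carried over; [esumT_le_past] passes to the total. *)
Lemma geometric_feasibility : feasibility phi.
Proof.
move=> r; apply: esumT_le_past => i.
have r0 : forall j : int, [set: int] j -> (0 <= (r j)%:E)%E.
  by move=> j _; rewrite lee_fin L1plus_ge0.
apply: le_trans (esum_subset (EFin \o r) (@subsetT _ [set j | j <= i])).
rewrite -(past_telescope lam01 r) (eq_esum (b := fun k => (lam k)%:E * wealth lam r k)%E).
  rewrite leeDl// mule_ge0 ?lee_fin ?subr_ge0//; last exact/wealth_ge0/L1plus_ge0.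
  by case/andP: (lam01 i).
by move=> k _; rewrite phi_wealth.
Qed.

Lemma geometric_scale_invariance : scale_invariance phi.
Proof.
move=> r alpha alpha0; apply: L1plus_eq => i; apply: EFin_inj => /=.
rewrite phi_wealth EFinM phi_wealth muleCA; congr (_ * _)%E.
rewrite -pastZl//; last by move=> j; rewrite lee_fin mulr_ge0 ?carry_ge0 ?L1plus_ge0.
by apply: eq_esum => j _ /=; rewrite -EFinM mulrCA.
Qed.

Lemma geometric_independence : independence_of_future_income phi.
Proof.
move=> j r r' rr' i ij; apply: EFin_inj; rewrite !phi_wealth.
by congr (_ * _)%E; apply: eq_wealth => k ki; apply: rr'; lia.
Qed.

(** The residual stream has the wealth of [r] at [j], by [wealth_residual], and the income of [r]
    afterwards; the recursion keeps both wealths equal from [j] on. *)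
Lemma geometric_consistency : consistency phi.
Proof.
move=> r j rj i ji; apply: EFin_inj; rewrite !phi_wealth; congr (_ * _)%E => /=.
have [_ rj0] := rj.
have -> : i = j + `|i - j|%N%:Z by lia.
elim: `|i - j|%N => [|n IH].
  rewrite addr0 (@wealth_singleton (residual_stream phi r j))//; last first.
    by move=> k kj; rewrite /residual_stream /= !ifF//; lia.
  rewrite {1}/residual_stream ltxx eqxx (wealth_residual (s := phi r))// => k _.
rewrite (_ : j + n.+1%:Z = j + n%:Z + 1); last by lia.
rewrite !wealth_recr ?IH//; last exact: L1plus_ge0.
by rewrite {2}/residual_stream (_ : j < _)//; lia.
Qed.

Lemma geometric_sup_continuity (b : R) :
  (forall i, Slam lam i <= b%:E)%E -> sup_continuity phi.
Proof.
move=> Sb; apply/sup_continuityP => r e e0.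
(* The bound [b] carries no sign, so a positive number above it is used as Lipschitz constant. *)
have B0 : 0 < `|b| + 1 by rewrite ltr_pwDr.
exists (e / (`|b| + 1)) => [|s sr i]; first by rewrite divr_gt0.
set d := e / _ in sr; have d0 : 0 <= d by rewrite ltW// divr_gt0.
(* A one-sided estimate, applied to the two streams in both orders. *)
have close (f g : L1plus R) : (forall j, f j <= g j + d) ->
    phi f i <= phi g i + e.
  move=> fg; rewrite -lee_fin EFinD !phi_wealth.
  apply: le_trans (wealth_dist i (L1plus_ge0 g) d0 fg) _.
  apply: leeD => //; apply: (@le_trans _ _ (d%:E * (`|b| + 1)%:E)%E).
    apply: lee_wpmul2l => //; apply: le_trans (Sb i) _; rewrite lee_fin.
    by rewrite (le_trans (ler_norm b))// lerDl.
  by rewrite -EFinM divfK// gt_eqF.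
rewrite ler_distl; apply/andP; split.
  rewrite lerBlDr; apply: close => j.
  by have := sr j; rewrite ler_distl lerBlDr => /andP[].
by apply: close => j; have := sr j; rewrite ler_distl => /andP[].
Qed.

End geometric_rule.

(** * Sums, indicators and truncations of streams *)

Lemma in_L1plusD (R : realType) (r s : L1plus R) :
  in_L1plus (fun i => r i + s i).
Proof.
split=> [|i]; last by rewrite addr_ge0// L1plus_ge0.
exact: (@summableD _ _ _ (EFin \o r) (EFin \o s) (stream_funP r).1 (stream_funP s).1).
Qed.

Lemma in_L1plus_indic (R : realType) (A : set int) : finite_set A ->
  in_L1plus (fun i => (i \in A)%:R : R).
Proof.
move=> finA; split=> [|i]; last by rewrite ler0n.
rewrite /in_L1 /summable.
rewrite (eq_esum (b := fun i => if i \in A then 1%E else 0%E)); last first.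
  by move=> i _ /=; case: (i \in A); rewrite ?normr1 ?normr0.
rewrite -esum_mkcond esum_fset// fsbig_finite//= sumEFin; exact: ltry.
Qed.

Definition indic_L1plus (R : realType) (A : set int) (finA : finite_set A) :
  L1plus R := MkL1plus (in_L1plus_indic R finA).

Lemma in_L1plus_restrict (R : realType) (A : set int) (r : L1plus R) :
  in_L1plus (fun i => if i \in A then r i else 0).
Proof.
apply: (in_L1plus_le (r := r)) => i.
by have := L1plus_ge0 r i; case: ifP => _ ->; rewrite lexx.
Qed.

Definition restrict_L1plus (R : realType) (A : set int) (r : L1plus R) :
  L1plus R := MkL1plus (in_L1plus_restrict A r).

Lemma restrict_pastE (R : realType) (r : L1plus R) (j k : int) :
  restrict_L1plus [set l | l <= j] r k = if k <= j then r k else 0.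
Proof. by congr (if _ then _ else _); apply/idP/idP; rewrite inE. Qed.

(** Take a finite [A] whose sum is within [d] of the total: the sum off [A] is then below [d] and
    dominates each of its terms. *)
Lemma L1plus_small_off_finite (R : realType) (r : L1plus R) (d : R) : 0 < d ->
  exists2 A : set int, finite_set A & forall i, ~ A i -> r i <= d.
Proof.
move=> d0; have := L1plus_esum_fin_num r setT.
move=> /(ub_ereal_sup_adherent d0)[_ [A [finA _] <-] Ad].
have r0 D : forall i, D i -> (0 <= (EFin \o r) i)%E.
  by move=> i _; rewrite lee_fin L1plus_ge0.
exists A => // i Ai; rewrite -lee_fin.
have : ((r i)%:E <= esum (~` A) (EFin \o r))%E.
  rewrite -[leLHS](esum_set1 (a := EFin \o r)); last exact: r0 setT _ _.
  by apply: esum_subset => _ ->.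
move=> /le_trans; apply; move: Ad.
have := @esumID _ _ A setT _ (r0 setT).
rewrite !setTI -(esum_fset finA); last by move=> j _; exact: r0 setT _ _.
have := L1plus_esum_fin_num r A; have := L1plus_esum_fin_num r (~` A).
rewrite -/(esum setT (EFin \o r)).
case: (esum (~` A) (EFin \o r)) => // x _; case: (esum A (EFin \o r)) => // y _ ->.
by rewrite -!EFinD lte_fin lee_fin => ?; apply: ltW; lra.
Qed.

(** * The axioms force a geometric rule *)

Definition unit_stream (R : realType) (j : int) : L1plus R :=
  indic_L1plus R (finite_set1 j).

Definition entry_rate (R : realType) (phi : L1plus R -> L1plus R) (i : int) : R :=
  phi (unit_stream R i) i.

Section axioms_imply_geometric.
Context {R : realType} (phi : L1plus R -> L1plus R).
Hypothesis phi_feas : feasibility phi.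
Hypothesis phi_scale : scale_invariance phi.
Hypothesis phi_indep : independence_of_future_income phi.
Hypothesis phi_cons : consistency phi.
Hypothesis phi_cont : sup_continuity phi.
Implicit Types (r s : L1plus R) (i j : int).

Local Notation delta := (unit_stream R).
Local Notation lam := (entry_rate phi).

Let deltaE j i : delta j i = (i == j)%:R.
Proof. by rewrite /= in_set1. Qed.

(** The unit stream has total 1, so feasibility caps each of its payments by 1. *)
Lemma rate_bounds i : 0 <= lam i <= 1.
Proof.
rewrite /entry_rate L1plus_ge0 /= -lee_fin.
have phi0 : forall j : int, [set: int] j -> (0 <= (phi (delta i) j)%:E)%E.
  by move=> j _; rewrite lee_fin L1plus_ge0.
rewrite -[leLHS](esum_set1 (a := EFin \o phi (delta i))) ?phi0//.
apply: le_trans (esum_subset (EFin \o phi (delta i)) (@subsetT _ [set i])) _.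
apply: le_trans (phi_feas (delta i)) _.
rewrite -[leRHS](esum_set1 (t := i) (a := cst 1%E))// [leRHS]esum_mkcond.
by apply: le_esum => j _ /=; case: (j \in [set i]).
Qed.

Lemma rule_zero r i : (forall j, r j = 0) -> phi r i = 0.
Proof.
move=> r0; have -> : r = scale_L1plus (lexx 0) r.
  by apply: L1plus_eq => j /=; rewrite mul0r r0.
by rewrite phi_scale /= mul0r.
Qed.

(** Independence alters a single coordinate at a time; the bound [N] leaves only finitely many to
    erase. *)
Lemma rule_restrict_past r (N j i : int) : (forall k, N < k -> r k = 0) ->
  i <= j -> phi r i = phi (restrict_L1plus [set k | k <= j] r) i.
Proof.
move=> rN ij.
pose t n := phi (restrict_L1plus [set k | k <= j + n%:Z] r) i.
have tE n : t n = t 0%N.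
  elim: n => // n <-; apply: (phi_indep (j := j + n.+1%:Z)); last by lia.
  move=> k kj; rewrite !restrict_pastE.
  by rewrite (_ : (k <= j + n.+1%:Z) = (k <= j + n%:Z))//; lia.
(* The cutoff [j + |N - j|] is at least [N], so this truncation is [r] itself. *)
have := tE `|N - j|%N; rewrite /t addr0 => <-; congr (phi _ i).
apply: L1plus_eq => k; rewrite restrict_pastE; case: ifPn => // kN.
by apply: rN; lia.
Qed.

Lemma rule_bounded_support r (n N : int) : (forall k, k < n -> r k = 0) ->
  (forall k, N < k -> r k = 0) ->
  forall i, ((phi r i)%:E = (lam i)%:E * wealth lam r i)%E.
Proof.
move=> rn rN i.
have r0 := L1plus_ge0 r.
(* Induction upward from the start [n] of the support; below [n] both sides vanish. *)
suff H m : forall i, i < n + m%:Z -> ((phi r i)%:E = (lam i)%:E * wealth lam r i)%E.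
  by apply: (H `|i - n|.+1%N); lia.
elim: m => [|m IH] {}i im.
  rewrite wealth0; last by move=> j ji; apply: rn; lia.
  rewrite mule0 (rule_restrict_past rN (lexx i)) rule_zero// => j.
  by rewrite restrict_pastE; case: ifP => // ji; apply: rn; lia.
have [im'|mi] := ltP i (n + m%:Z); first exact: IH.
have past_paid k : k < i -> ((phi r k)%:E = (lam k)%:E * wealth lam r k)%E.
  by move=> ki; apply: IH; lia.
have resE := wealth_residual rate_bounds past_paid.
set c := _ + _ in resE.
have c0 : 0 <= c by rewrite -lee_fin resE wealth_ge0//; exact: rate_bounds.
have resi : residual_stream phi r i i = c by rewrite /residual_stream ltxx eqxx.
have resf k : i < k -> residual_stream phi r i k = r k.
  by rewrite /residual_stream => ->.
have resp k : k < i -> residual_stream phi r i k = 0.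
  by move=> ki; rewrite /residual_stream !ifF//; lia.
(* Consistency applies only to a residual stream in [L1plus]; this one is dominated by [r] plus [c]
   times the unit stream at [i]. *)
have res_L1 : in_L1plus (residual_stream phi r i).
  apply: (in_L1plus_le (r := MkL1plus (in_L1plusD r (scale_L1plus c0 (delta i))))).
  move=> k; have -> : MkL1plus (in_L1plusD r (scale_L1plus c0 (delta i))) k =
      r k + c * (k == i)%:R by rewrite -deltaE.
  have [ki|ik|->] := ltgtP k i.
  - by rewrite resp// lexx addr_ge0// mulr_ge0.
  - by rewrite resf// r0 lerDl mulr_ge0.
  - by rewrite resi c0 mulr1 lerDr r0.
(* The residual stream may be nonzero at [i] even when [N < i], hence the maximum. Truncated at [i],
   it is [c] times the unit stream, which scale invariance evaluates. *)
rewrite -resE (phi_cons res_L1)// (@rule_restrict_past _ (Order.max N i) i)//; last first.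
  by move=> k; rewrite gt_max => /andP[Nk ik] /=; rewrite resf// rN.
rewrite (_ : restrict_L1plus _ _ = scale_L1plus c0 (delta i)).
  by rewrite phi_scale /= mulrC EFinM.
apply: L1plus_eq => k; rewrite restrict_pastE /=.
have -> : (k \in [set i]) = (k == i) by rewrite in_set1.
have [ki|ik|->] := ltgtP k i; last by rewrite resi mulr1.
- by rewrite resp// mulr0.
- by rewrite mulr0.
Qed.

Lemma rule_finite_support r (A : set int) : finite_set A ->
  (forall k, ~ A k -> r k = 0) ->
  forall i, ((phi r i)%:E = (lam i)%:E * wealth lam r i)%E.
Proof.
move=> /finite_set_int_bounded[m Am] r0.
by apply: (@rule_bounded_support _ (- m%:Z) m%:Z) => k mk; apply: r0 => /Am; lia.
Qed.

(** Continuity at zero with tolerance 1 gives a radius [d]; if [r] is at most 1, then [d * r] is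
    within [d] of zero, so [d * phi r i] is at most 1. *)
Lemma rule_bounded_on_unit_ball :
  exists2 b : R, 0 < b & forall r, (forall i, r i <= 1) -> forall i, phi r i <= b.
Proof.
pose z := scale_L1plus (lexx 0) (delta 0).
have z0 i : z i = 0 by rewrite /= mul0r.
have [d d0 zd] := (sup_continuityP phi).1 phi_cont z 1 ltr01.
exists d^-1 => [|r r1 i]; first by rewrite invr_gt0.
have := zd (scale_L1plus (ltW d0) r) _ i.
rewrite phi_scale (rule_zero i z0) /= subr0 ger0_norm; last first.
  by rewrite mulr_ge0 ?L1plus_ge0 ?ltW.
rewrite -[d^-1]mul1r ler_pdivlMr// mulrC; apply=> j.
have := r1 j; have := L1plus_ge0 r j; rewrite mul0r subr0 => rj0 rj1.
by have d_ge0 := ltW d0; rewrite ger0_norm ?mulr_ge0 ?ler_piMr.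
Qed.

(** A partial sum over a finite [X] is at most the payment at [i] to the indicator stream of [X],
    which lies in the unit ball. *)
Lemma Slam_bounded : exists2 b : R, 0 < b & forall i, (Slam lam i <= b%:E)%E.
Proof.
have [b b0 phib] := rule_bounded_on_unit_ball; exists b => // i.
rewrite /Slam -pastZl; last 2 first.
- by case/andP: (rate_bounds i).
- by move=> j; rewrite lee_fin carry_ge0//; exact: rate_bounds.
apply: ge_ereal_sup => _ [X [finX Xi] <-].
pose x := indic_L1plus R finX.
have x1 j : x j <= 1 by rewrite /=; case: (j \in X).
apply: (@le_trans _ _ (phi x i)%:E); last by rewrite lee_fin phib.
rewrite (rule_finite_support finX); last by move=> k kX /=; rewrite memNset.
rewrite -pastZl; last 2 first.
- by case/andP: (rate_bounds i).
- move=> j; rewrite lee_fin mulr_ge0 ?L1plus_ge0// carry_ge0//.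
  exact: rate_bounds.
apply: ereal_sup_ubound; exists X => //; apply: eq_fsbigr => j jX.
by rewrite /= jX mulr1.
Qed.

Lemma rule_geometric : is_geometric_rule lam phi.
Proof.
move=> r i; rewrite -/(wealth lam r i).
have [b b0 Sb] := Slam_bounded.
have r0 := L1plus_ge0 r.
have lam0 j : 0 <= lam j by case/andP: (rate_bounds j).
have fin : ((lam i)%:E * wealth lam r i)%E \is a fin_num.
  by rewrite fin_numM// wealth_fin_num//; exact: rate_bounds.
rewrite -(fineK fin); congr EFin; set g := fine _.
apply/eqP; rewrite -subr_eq0 -normr_le0; apply/ler_addgt0Pr => e e0.
have e20 : 0 < e / 2 by rewrite divr_gt0.
have [d d0 rd] := (sup_continuityP phi).1 phi_cont r _ e20.
(* The bound [d] keeps [phi x] within [e / 2] of [phi r]; the bound [e / 2 / b] keeps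
   [d' * Slam lam i] below or equal to [e / 2]. *)
set d' := Order.min d (e / 2 / b).
have d'0 : 0 < d' by rewrite lt_min d0 divr_gt0.
have [A finA Ad] := L1plus_small_off_finite r d'0.
pose x := restrict_L1plus A r.
have x_le j : x j <= r j by rewrite /=; case: ifP.
have r_le j : r j <= x j + d'.
  rewrite /=; case: ifPn => [_|/negP]; first by rewrite lerDl ltW.
  by rewrite inE add0r => /Ad.
have xg : (phi x i)%:E = ((lam i)%:E * wealth lam x i)%E.
  by apply: (rule_finite_support finA) => k kA /=; rewrite memNset.
(* The truncation [x] has finite support, so its payment is already known to be geometric and can be
   compared with [g] through wealth. *)
have lower : phi x i <= g.
  rewrite -lee_fin fineK// xg lee_wpmul2l ?lee_fin//; apply: le_esum => j _.
  by rewrite lee_fin ler_wpM2l// carry_ge0//; exact: rate_bounds.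
have upper : g <= phi x i + e / 2.
  rewrite -lee_fin EFinD fineK// xg.
  apply: le_trans (wealth_dist rate_bounds i (L1plus_ge0 x) (ltW d'0) r_le) _.
  apply: leeD => //; apply: (@le_trans _ _ (d'%:E * b%:E)%E).
    by rewrite lee_wpmul2l// lee_fin ltW.
  by rewrite -EFinM lee_fin -ler_pdivlMr// ge_min lexx orbT.
have close : `|phi x i - phi r i| <= e / 2.
  apply: rd => j; rewrite ler_norml.
  have := r_le j; have := x_le j; have : d' <= d by rewrite ge_min lexx.
  by move=> ? ? ?; apply/andP; split; lra.
by move: close; rewrite !ler_norml => /andP[? ?]; apply/andP; split; lra.
Qed.

End axioms_imply_geometric.

Theorem theorem2 (R : realType) (phi : L1plus R -> L1plus R) :
  (feasibility phi /\ scale_invariance phi /\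
   independence_of_future_income phi /\ consistency phi /\
   sup_continuity phi)
  <->
  (exists lam : int -> R,
     (forall i : int, 0 <= lam i <= 1) /\
     is_geometric_rule lam phi /\
     (exists b : R, forall i : int, (Slam lam i <= b%:E)%E)).
Proof.
split=> [[feas [scale [indep [cons cont]]]]|[lam [lam01 [phiE [b Sb]]]]].
  exists (entry_rate phi); split; first exact: rate_bounds.
  split; first exact: rule_geometric.
  by have [b _ Sb] := Slam_bounded feas scale indep cons cont; exists b.
split; first exact: geometric_feasibility lam01 _ phiE.
split; first exact: geometric_scale_invariance lam01 _ phiE.
split; first exact: geometric_independence phiE.
split; first exact: geometric_consistency lam01 _ phiE.
exact: geometric_sup_continuity lam01 _ phiE _ Sb.
Qed.
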